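(* Let $S$ be a semigroup, and let $\approx$ denote any of the relations $\sim_p^1$, $\sim_p$, $\sim_s^1$ on $S$. Then $\sim_s$ is the congruence on $S$ generated by $\approx$, and $\sim_s$ is the least congruence $\rho$ on $S$ such that $S/\rho$ is commutative.
   Context: For a semigroup $S$, $S^1$ denotes the monoid obtained by adjoining an identity element $1$ to $S$; if $S$ is already a monoid, $S^1=S$. For $s,t\in S$: $s\sim_p^1 t$ means there exist $p,r\in S^1$ with $s=pr$ and $t=rp$; $\sim_p$ is the transitive closure of $\sim_p^1$; $s\sim_s^1 t$ means there exist a positive integer $n$, elements $p_1,\dots,p_n\in S^1$, and a permutation $f$ of $\{1,\dots,n\}$ with $s=p_1\cdots p_n$ and $t=p_{f(1)}\cdots p_{f(n)}$; $\sim_s$ is the transitive closure of $\sim_s^1$. A congruence on $S$ is an equivalence relation $\rho$ such that $s\,\rho\,t$ implies $(sr)\,\rho\,(tr)$ and $(rs)\,\rho\,(rt)$ for all $r,s,t\in S$. The congruence generated by a relation is the least congruence containing it. *)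

(* Defs.v *)
From HB Require Import structures.
From Stdlib Require Export Relation_Definitions Relation_Operators.
From mathcomp Require Export all_boot perm.
From mathcomp Require Import boolp.

Set Implicit Arguments.
Unset Strict Implicit.
Unset Printing Implicit Defensive.

Local Open Scope group_scope.
Local Open Scope quotient_scope.

Definition is_identity (S : semigroupType) (e : S) : Prop :=
  left_id e (@mul S) /\ right_id e (@mul S).

(* The monoid S^1.  The extra element is available only if S has no identity,
   so that S^1 is S itself (up to [Emb]) whenever S is already a monoid. *)
Inductive adjoin1 (S : semigroupType) : Type :=
| Emb of S
| Adj of ~ (exists e : S, is_identity e).

Arguments Adj {S} _.

Section Adjoin1.
Variable S : semigroupType.
Implicit Types x y z : adjoin1 S.

HB.instance Definition _ := gen_eqMixin (adjoin1 S).
HB.instance Definition _ := gen_choiceMixin (adjoin1 S).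

Definition adjoin1_mul x y : adjoin1 S :=
  match x, y with
  | Emb s, Emb t => Emb (s * t)
  | Emb _, Adj _ => x
  | Adj _, _ => y
  end.

Definition adjoin1_one : adjoin1 S :=
  match pselect (exists e : S, is_identity e) with
  | left h => Emb (sval (cid h))
  | right h => Adj h
  end.

Lemma adjoin1_mulA : associative adjoin1_mul.
Proof. by move=> [s|?] [t|?] [u|?] //=; rewrite mulgA. Qed.

Lemma adjoin1_1mul : left_id adjoin1_one adjoin1_mul.
Proof.
rewrite /adjoin1_one; case: pselect => [h|h]; last by [].
case: cid => e [el er] [s|n] /=; first by rewrite el.
by case: (n h).
Qed.

Lemma adjoin1_mul1 : right_id adjoin1_one adjoin1_mul.
Proof.
rewrite /adjoin1_one; case: pselect => [h|h] x.
  case: cid => e [el er]; case: x => [s|n] /=; first by rewrite er.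
  by case: (n h).
by case: x => [s|n] //=; congr Adj; exact: Prop_irrelevance.
Qed.

HB.instance Definition _ := isSemigroup.Build (adjoin1 S) adjoin1_mulA.
HB.instance Definition _ :=
  Semigroup_isMonoid.Build (adjoin1 S) adjoin1_1mul adjoin1_mul1.

End Adjoin1.

Section Conjugacy.
Variable S : semigroupType.

Definition sim_p1 : relation S := fun s t =>
  exists p r : adjoin1 S, Emb s = p * r /\ Emb t = r * p.

Definition sim_p : relation S := clos_trans S sim_p1.

Definition sim_s1 : relation S := fun s t =>
  exists (n : nat) (p : 'I_n -> adjoin1 S) (f : 'S_n),
    [/\ (0 < n)%N, Emb s = \prod_(i < n) p i & Emb t = \prod_(i < n) p (f i)].

Definition sim_s : relation S := clos_trans S sim_s1.

End Conjugacy.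

Record is_congruence (S : semigroupType) (rho : relation S) : Prop :=
  IsCongruence {
    congr_equiv : equivalence S rho;
    congr_mul : forall r s t : S, rho s t ->
      rho (s * r) (t * r) /\ rho (r * s) (r * t)
  }.

Section Quotient.
Variables (S : semigroupType) (rho : relation S) (C : is_congruence rho).

Let rhob : rel S := fun s t => `[< rho s t >].

Lemma congr_equiv_class : equiv_class_of rhob.
Proof.
have [[r t s] _] := C; split=> [x|x y|y x z].
- by apply/asboolP; apply: r.
- by apply/asboolP/asboolP; apply: s.
- by move=> /asboolP xy /asboolP yz; apply/asboolP; apply: t xy yz.
Qed.

Canonical congr_equiv_rel : equiv_rel S := EquivRelPack congr_equiv_class.

Definition congr_quot : Type := {eq_quot congr_equiv_rel}.

HB.instance Definition _ := Choice.on congr_quot.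
HB.instance Definition _ := EqQuotient.on congr_quot.

(* Computed on representatives; see [congr_quot_mul_pi] below for independence
   of the choice of representatives. *)
Definition congr_quot_mul : congr_quot -> congr_quot -> congr_quot :=
  fun a b => \pi_congr_quot (repr a * repr b).

Lemma congr_quot_eqE (s t : S) : \pi_congr_quot s = \pi_congr_quot t <-> rho s t.
Proof.
split=> [/eqP|h]; first by rewrite eqmodE => /asboolP.
by apply/eqP; rewrite eqmodE; apply/asboolP.
Qed.

Lemma congr_quot_mul_pi (s t : S) :
  congr_quot_mul (\pi_congr_quot s) (\pi_congr_quot t) = \pi_congr_quot (s * t).
Proof.
have reprR (u : S) : rho (repr (\pi_congr_quot u)) u by apply/congr_quot_eqE; rewrite reprK.
have [[_ tr _] M] := C.
apply/congr_quot_eqE; apply: (tr _ (s * repr (\pi_congr_quot t))).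
- exact: (M _ _ _ (reprR s)).1.
- exact: (M _ _ _ (reprR t)).2.
Qed.

Lemma congr_quot_mulA : associative congr_quot_mul.
Proof.
elim/quotW => a; elim/quotW => b; elim/quotW => c.
rewrite (congr_quot_mul_pi b c) (congr_quot_mul_pi a b).
by rewrite (congr_quot_mul_pi a (b * c)) (congr_quot_mul_pi (a * b) c) mulgA.
Qed.

HB.instance Definition _ := isSemigroup.Build congr_quot congr_quot_mulA.

End Quotient.

Definition least (S : Type) (P : relation S -> Prop) (rho : relation S) : Prop :=
  P rho /\ forall sigma : relation S, P sigma -> inclusion S rho sigma.

Definition is_generated_congruence (S : semigroupType) (R : relation S) :
    relation S -> Prop :=
  least (fun rho => is_congruence rho /\ inclusion S R rho).

Definition is_commutative_congruence (S : semigroupType) (rho : relation S) :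
    Prop :=
  exists C : is_congruence rho, commutative (@mul (congr_quot C)).

(* Main.v *)
Require Import Defs.

(** Everything follows from one fact about factorizations: if a congruence on a
    monoid relates [x * y] to [y * x] for all [x] and [y], then it relates any
    two products of the same elements taken in different orders
    ([prod_perm_congr]).

    A congruence [rho] on [S] extends to the congruence [adjoin1_rel rho] on
    [S^1] in which an adjoined identity is related only to itself. If [rho]
    relates [s * t] to [t * s] for all [s] and [t], the extension does the same
    on [S^1], so [rho] contains [sim_s] ([sim_s_sub_congruence]). This bounds
    [sim_s] from above in both halves of the theorem, because the condition
    [rho (s * t) (t * s)] says that the quotient by [rho] is commutative, and
    it holds as soon as [rho] contains [sim_p1].

    Conversely, [sim_s] is itself a congruence, since a rearrangement stays a
    rearrangement when a common factor is put on one side, and it contains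
    [sim_p1] because exchanging two factors is a rearrangement. The relations
    [sim_p1], [sim_p] and [sim_s1] all lie between [sim_p1] and [sim_s], hence
    generate the same congruence. *)

Set Implicit Arguments.
Unset Strict Implicit.
Unset Printing Implicit Defensive.

Local Open Scope group_scope.

(** * Rearranged products modulo a congruence *)

(** Induction on one list: bring its head to the front of the other product by
    a single exchange with the block of factors that precedes it. *)
Lemma prod_perm_congr (M : monoidType) (R : relation M) (ps qs : seq M) :
  is_congruence R -> (forall x y, R (x * y) (y * x)) -> perm_eq ps qs ->
  R (\prod_(p <- ps) p) (\prod_(q <- qs) q).
Proof.
move=> [[R_refl R_trans _] R_mul] R_comm.
elim: ps qs => [|p ps IHps] qs.
  by rewrite perm_sym => /perm_nilP->; apply: R_refl.
move=> eq_qs; have: p \in qs by rewrite -(perm_mem eq_qs) mem_head.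
move=> p_qs; case/splitPr: p_qs eq_qs => qs1 qs2 eq_qs.
have /IHps ps_qs : perm_eq ps (qs1 ++ qs2).
  by rewrite -(perm_cons p) (perm_trans eq_qs) // perm_catC /= perm_cons perm_catC.
rewrite big_cons.
apply: (R_trans _ (p * \prod_(q <- qs1 ++ qs2) q)); first exact: (R_mul _ _ _ ps_qs).2.
rewrite !big_cat /= big_cons !mulgA.
exact: (R_mul _ _ _ (R_comm _ _)).1.
Qed.

(** * Extending a congruence to the monoid with adjoined identity *)

Definition adjoin1_rel (S : semigroupType) (rho : relation S) :
    relation (adjoin1 S) := fun x y =>
  match x, y with
  | Emb s, Emb t => rho s t
  | Adj _, Adj _ => True
  | _, _ => False
  end.

Lemma adjoin1_rel_congruence (S : semigroupType) (rho : relation S) :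
  is_congruence rho -> is_congruence (adjoin1_rel rho).
Proof.
move=> [[rho_refl rho_trans rho_sym] rho_mul]; split; first split.
- by move=> [s|?] /=.
- by move=> [s|?] [t|?] [u|?] //=; apply: rho_trans.
- by move=> [s|?] [t|?] //=; apply: rho_sym.
move=> [r|?] [s|?] [t|?] //= st.
exact: rho_mul.
Qed.

Lemma adjoin1_rel_comm (S : semigroupType) (rho : relation S) :
  is_congruence rho -> (forall s t, rho (s * t) (t * s)) ->
  forall x y, adjoin1_rel rho (x * y) (y * x).
Proof.
move=> [[rho_refl _ _] _] rho_comm [s|?] [t|?] //=.
Qed.

(** * Rearranged factorizations *)

(** Factorizations as lists can be extended by a factor and compared with
    [perm_eq] without reindexing any permutation. The empty list adds nothing
    new: prepending [1] to both lists makes the number of factors positive. *)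
Lemma sim_s1P (S : semigroupType) (s t : S) :
  sim_s1 s t <->
  exists ps qs : seq (adjoin1 S),
    [/\ perm_eq ps qs, Emb s = \prod_(p <- ps) p & Emb t = \prod_(q <- qs) q].
Proof.
split=> [[n [p [f [_ s_def t_def]]]]|[ps [qs [eq_ps_qs s_def t_def]]]].
  exists [seq p i | i <- index_enum 'I_n], [seq p (f i) | i <- index_enum 'I_n].
  rewrite !big_map; split=> //.
  rewrite (map_comp p f) perm_map // uniq_perm ?index_enum_uniq //.
    by rewrite (map_inj_uniq perm_inj) index_enum_uniq.
  move=> i; rewrite mem_index_enum; apply/esym/mapP.
  by exists (f^-1 i); rewrite ?mem_index_enum ?permKV.
have : perm_eq (1 :: qs) (in_tuple (1 :: ps)) by rewrite perm_cons perm_sym.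
case/tuple_permP=> f qs_def.
exists (size ps).+1, (tnth (in_tuple (1 :: ps))), f; split=> //.
  by rewrite -(big_tuple _ _ (in_tuple (1 :: ps)) predT id) big_cons mul1g.
transitivity (\prod_(q <- 1 :: qs) q); first by rewrite big_cons mul1g.
by rewrite qs_def /= big_map enumT [index_enum _]unlock.
Qed.

Lemma sim_s1_refl (S : semigroupType) (s : S) : sim_s1 s s.
Proof. by apply/sim_s1P; exists [:: Emb s], [:: Emb s]; rewrite !big_seq1. Qed.

Lemma sim_s1_sym (S : semigroupType) (s t : S) : sim_s1 s t -> sim_s1 t s.
Proof.
move=> /sim_s1P[ps [qs [eq_ps_qs s_def t_def]]].
by apply/sim_s1P; exists qs, ps; rewrite perm_sym.
Qed.

Lemma sim_s1_mul (S : semigroupType) (r s t : S) :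
  sim_s1 s t -> sim_s1 (s * r) (t * r) /\ sim_s1 (r * s) (r * t).
Proof.
move=> /sim_s1P[ps [qs [eq_ps_qs s_def t_def]]]; split; apply/sim_s1P.
  exists (ps ++ [:: Emb r]), (qs ++ [:: Emb r]).
  by rewrite perm_cat2r !big_cat /= !big_seq1 -s_def -t_def.
exists (Emb r :: ps), (Emb r :: qs).
by rewrite perm_cons !big_cons -s_def -t_def.
Qed.

Lemma sim_p1_sub_sim_s1 (S : semigroupType) : inclusion S (@sim_p1 S) (@sim_s1 S).
Proof.
move=> s t [p [r [s_def t_def]]]; apply/sim_s1P; exists [:: p; r], [:: r; p].
by rewrite (perm_catC [:: p] [:: r]) !big_cons !big_nil !mulg1.
Qed.

Lemma sim_p1_mulC (S : semigroupType) (s t : S) : sim_p1 (s * t) (t * s).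
Proof. by exists (Emb s), (Emb t). Qed.

(** * The relation sim_s as a congruence *)

Lemma clos_trans_min (A : Type) (R T : relation A) :
  Relation_Definitions.transitive A T -> inclusion A R T -> inclusion A (clos_trans A R) T.
Proof.
move=> T_trans sub_R_T x y; elim=> {x y} [x y /sub_R_T //|x y z _ xy _ yz].
exact: T_trans xy yz.
Qed.

Lemma sim_s_congruence (S : semigroupType) : is_congruence (@sim_s S).
Proof.
split; first split.
- by move=> s; apply/t_step/sim_s1_refl.
- by move=> s t u; apply: t_trans.
- move=> s t; elim=> {s t} [s t /sim_s1_sym st|s t u _ ts _ ut].
    exact: t_step.
  exact: t_trans ut ts.
move=> r s t; elim=> {s t} [s t /(sim_s1_mul r)[str rst]|].
  by split; apply: t_step.
by move=> s t u _ [str rst] _ [tur rtu]; split; [apply: t_trans tur|apply: t_trans rtu].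
Qed.

Lemma sim_s_sub_congruence (S : semigroupType) (rho : relation S) :
  is_congruence rho -> (forall s t, rho (s * t) (t * s)) ->
  inclusion S (@sim_s S) rho.
Proof.
move=> rho_congr rho_comm; have [[_ rho_trans _] _] := rho_congr.
apply: clos_trans_min => // s t /sim_s1P[ps [qs [eq_ps_qs s_def t_def]]].
suff: adjoin1_rel rho (Emb s) (Emb t) by [].
rewrite s_def t_def; apply: prod_perm_congr eq_ps_qs.
  exact: adjoin1_rel_congruence.
exact: adjoin1_rel_comm.
Qed.

(** Multiplication in the quotient is computed on chosen representatives, so
    commutativity is transferred through [congr_quot_mul_pi]. *)
Lemma is_commutative_congruenceP (S : semigroupType) (rho : relation S) :
  is_commutative_congruence rho <->
  is_congruence rho /\ forall s t, rho (s * t) (t * s).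
Proof.
split=> [[C mulC]|[C rho_comm]].
  split=> // s t; apply/(congr_quot_eqE C).
  by rewrite -!congr_quot_mul_pi; apply: mulC.
exists C; elim/quotW=> s; elim/quotW=> t.
by rewrite /mul /= !congr_quot_mul_pi; apply/congr_quot_eqE.
Qed.

Theorem theorem5 (S : semigroupType) :
  (forall approx : relation S,
     [\/ approx = @sim_p1 S, approx = @sim_p S | approx = @sim_s1 S] ->
     is_generated_congruence approx (@sim_s S))
  /\ least (@is_commutative_congruence S) (@sim_s S).
Proof.
have sub_p1_s : inclusion S (@sim_p1 S) (@sim_s S).
  by move=> s t /sim_p1_sub_sim_s1; apply: t_step.
split=> [approx approxE|].
  have sub_p1 : inclusion S (@sim_p1 S) approx.
    case: approxE => -> // s t; first exact: t_step.
    exact: sim_p1_sub_sim_s1.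
  have sub_s : inclusion S approx (@sim_s S).
    case: approxE => -> //; last by move=> s t; apply: t_step.
    by apply: clos_trans_min => // s t u; apply: t_trans.
  split=> [|rho [rho_congr sub_rho]]; first by split=> //; apply: sim_s_congruence.
  apply: sim_s_sub_congruence => // s t.
  exact/sub_rho/sub_p1/sim_p1_mulC.
split=> [|rho /is_commutative_congruenceP[rho_congr rho_comm]].
  apply/is_commutative_congruenceP; split; first exact: sim_s_congruence.
  by move=> s t; apply/sub_p1_s/sim_p1_mulC.
exact: sim_s_sub_congruence.
Qed.
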